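(* Let $\mathbb{k}$ be a field. For each integer $a\geq 1$, there exists a graph $G_a$ satisfying $$|G_a|-\operatorname{i}(G_a)+a<\operatorname{proj-dim}(G_a)<|G_a|-\gamma(G_a)-a .$$
   Context: Graphs are finite, without loops or multiple edges; $|G|$ is the number of vertices of $G$. A set $A\subseteq V(G)$ is dominating if its closed neighbourhood $N_G[A]$ equals $V(G)$. The domination number $\gamma(G)$ is the minimum size of a dominating set, and the independent domination number $\operatorname{i}(G)$ is the minimum size of an independent dominating set of $G$. For a field $\mathbb{k}$ and a graph $G$ on $V$, $\operatorname{proj-dim}(G):=\operatorname{proj-dim}(R/I_G)$, where $R=\mathbb{k}[V]$ and $I_G=(xy:xy\in E(G))$. *)

(* Defs.v *)
From HB Require Import structures.
From mathcomp Require Import all_boot all_order all_algebra.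
From mathcomp Require Import generic_quotient ring_quotient.
From mathcomp Require Import boolp.
From mathcomp Require Import mpoly.

Set Implicit Arguments.
Unset Strict Implicit.
Unset Printing Implicit Defensive.

Import GRing.Theory.

Local Open Scope ring_scope.

Record sgraph := SGraph {
  vert :> finType;
  adj : rel vert;
  adj_sym : ssrbool.symmetric adj;
  adj_irr : irreflexive adj }.

Section Domination.
Variable G : sgraph.

Definition closed_nbhd (A : {set G}) : {set G} :=
  [set y | (y \in A) || [exists x in A, adj x y]].

Definition dominating (A : {set G}) : bool := closed_nbhd A == [set: G].

Definition independent (A : {set G}) : bool :=
  [forall x in A, forall y in A, ~~ adj x y].

(* In the next two definitions the default value #|G| of the minimum cannot
   affect the result: every set of vertices has at most #|G| elements, and the
   minimum is over a nonempty family (see [dominating_setT] and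
   [ex_independent_dominating]). *)
Definition domination_number : nat :=
  \big[minn/#|G|]_(A : {set G} | dominating A) #|A|.

Definition independent_domination_number : nat :=
  \big[minn/#|G|]_(A : {set G} | independent A && dominating A) #|A|.

Lemma dominating_setT : dominating [set: G].
Proof. by apply/eqP/setP => x; rewrite !inE. Qed.

Lemma ex_independent_dominating :
  exists A : {set G}, independent A && dominating A.
Proof.
have i0 : independent set0 by apply/'forall_implyP => x; rewrite inE.
have [A /maxsetP[iA maxA] _] := maxset_exists i0.
exists A; rewrite iA /=; apply/eqP/setP => y; rewrite !inE.
have [//|yA /=] := boolP (y \in A); apply: contraT => nex.
have nadj x : x \in A -> ~~ adj x y.
  by move=> xA; apply: contra nex => exy; apply/existsP; exists x; rewrite xA.
have/maxA : independent (y |: A).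
  apply/'forall_implyP => u /setU1P uA; apply/'forall_implyP => v /setU1P vA.
  case: uA vA => [->|uA] [->|vA]; first by rewrite adj_irr.
  - by rewrite adj_sym nadj.
  - exact: nadj.
  - by move/'forall_implyP: iA => /(_ u uA)/'forall_implyP/(_ v vA).
by move=> /(_ (subsetUr _ _)) eA; rewrite -eA setU11 in yA.
Qed.

End Domination.

Section ProjectiveDimension.
Variable R : pzRingType.

Definition projective (P : lmodType R) : Prop :=
  forall (M N : lmodType R) (g : {linear M -> N}) (f : {linear P -> N}),
    (forall y, exists x, g x = y) ->
    exists h : {linear P -> M}, forall x, g (h x) = f x.

(* ... -> P 1 -> P 0 -> M -> 0, the arrow from P i.+1 to P i being [dif i] *)
Record projective_resolution (M : lmodType R) := ProjectiveResolution {
  res_mod : nat -> lmodType R;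
  res_dif : forall i, {linear res_mod i.+1 -> res_mod i};
  res_aug : {linear res_mod 0%N -> M};
  res_proj : forall i, projective (res_mod i);
  res_aug_surj : forall y, exists x, res_aug x = y;
  res_exact0 : forall x, res_aug x = 0 <-> exists z, res_dif 0%N z = x;
  res_exact : forall i x,
    res_dif i x = 0 <-> exists z, res_dif i.+1 z = x }.

Definition res_length_le (M : lmodType R) (P : projective_resolution M)
    (n : nat) : Prop :=
  forall i, (n < i)%N -> forall x : res_mod P i, x = 0.

Definition has_resolution_le (M : lmodType R) (n : nat) : Prop :=
  exists P : projective_resolution M, res_length_le P n.

(* The projective dimension of M may be infinite, so it is given as a relation:
   [is_projdim M d] says that it is finite and equal to d. *)
Definition is_projdim (M : lmodType R) (d : nat) : Prop :=
  has_resolution_le M d /\ forall n, has_resolution_le M n -> (d <= n)%N.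

End ProjectiveDimension.

Section EdgeIdeal.
Variables (k : fieldType) (G : sgraph).

(* k[V], the vertices being numbered by [enum_rank] *)
Definition vpoly : comNzRingType := {mpoly k[#|G|]}.

Definition vvar (x : G) : vpoly := 'X_(enum_rank x).

Definition edge_ideal : {pred vpoly} := fun p =>
  `[< exists c : G -> G -> vpoly,
        p = \sum_(x : G) \sum_(y | adj x y) c x y * (vvar x * vvar y) >].

Lemma edge_idealP p :
  reflect (exists c : G -> G -> vpoly,
             p = \sum_(x : G) \sum_(y | adj x y) c x y * (vvar x * vvar y))
          (p \in edge_ideal).
Proof. exact: asboolP. Qed.

Fact edge_ideal_zmod_closed : zmod_closed edge_ideal.
Proof.
split=> [|p q /edge_idealP[c ->] /edge_idealP[d ->]]; apply/edge_idealP.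
  by exists (fun _ _ => 0); rewrite big1 // => x _; rewrite big1 // => y _;
    rewrite mul0r.
exists (fun x y => c x y - d x y); rewrite -sumrB; apply: eq_bigr => x _.
by rewrite -sumrB; apply: eq_bigr => y _; rewrite mulrBl.
Qed.

HB.instance Definition _ :=
  GRing.isZmodClosed.Build vpoly edge_ideal edge_ideal_zmod_closed.

Lemma edge_idealMl (a p : vpoly) : p \in edge_ideal -> a * p \in edge_ideal.
Proof.
case/edge_idealP=> c ->; apply/edge_idealP; exists (fun x y => a * c x y).
rewrite mulr_sumr; apply: eq_bigr => x _.
by rewrite mulr_sumr; apply: eq_bigr => y _; rewrite mulrA.
Qed.

Definition edge_quot : Type := {ideal_quot edge_ideal}.

HB.instance Definition _ := GRing.Zmodule.on edge_quot.
HB.instance Definition _ := EqQuotient.on edge_quot.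

Definition edge_pi (p : vpoly) : edge_quot := (\pi_(edge_quot) p)%qT.

Definition edge_scale (a : vpoly) (u : edge_quot) : edge_quot :=
  edge_pi (a * repr u).

Lemma edge_piP p q : edge_pi p = edge_pi q <-> p - q \in edge_ideal.
Proof. by rewrite Quotient.idealrBE; split=> [e|/eqP//]; apply/eqP. Qed.

Lemma edge_pi_surj u : exists p, edge_pi p = u.
Proof. by exists (repr u); exact: reprK. Qed.

Lemma edge_piD p q : edge_pi (p + q) = edge_pi p + edge_pi q.
Proof. exact: Quotient.pi_add. Qed.

Lemma edge_scaleE a p : edge_scale a (edge_pi p) = edge_pi (a * p).
Proof.
apply/edge_piP; rewrite -mulrBr edge_idealMl //; apply/edge_piP.
exact: reprK.
Qed.

Fact edge_scaleA a b u : edge_scale a (edge_scale b u) = edge_scale (a * b) u.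
Proof. by have [p <-] := edge_pi_surj u; rewrite !edge_scaleE mulrA. Qed.

Fact edge_scale1 : left_id 1 edge_scale.
Proof.
by move=> u; have [p <-] := edge_pi_surj u; rewrite edge_scaleE mul1r.
Qed.

Fact edge_scaleDr : right_distributive edge_scale +%R.
Proof.
move=> a u v; have [p <-] := edge_pi_surj u; have [q <-] := edge_pi_surj v.
by rewrite -edge_piD !edge_scaleE mulrDr edge_piD.
Qed.

Fact edge_scaleDl u : {morph edge_scale^~ u : a b / a + b}.
Proof.
move=> a b; have [p <-] := edge_pi_surj u.
by rewrite !edge_scaleE mulrDl edge_piD.
Qed.

HB.instance Definition _ := GRing.Zmodule_isLmodule.Build vpoly edge_quot
  edge_scaleA edge_scale1 edge_scaleDr edge_scaleDl.

(* R / I_G as a module over R = k[V] *)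
Definition edge_module : lmodType vpoly := edge_quot.

Definition is_graph_projdim (d : nat) : Prop := is_projdim edge_module d.

End EdgeIdeal.

(* Main.v *)
Require Import Defs.
From mathcomp Require Import all_boot all_order all_algebra.
From HB Require Import structures.
From mathcomp Require Import generic_quotient ring_quotient boolp mpoly freeg.
From mathcomp Require Import zify.

(** The graph is the path on four vertices 0 - 1 - 2 - 3 with every vertex
replaced by an independent set (a layer) of m = a + 2 vertices, and every edge
by all edges between the two layers. It has 4m vertices. One vertex in layer 1
and one in layer 2 dominate it, while an independent dominating set is a union
of layers and contains at least two of them, because vertices of one layer have
the same neighbours; so gamma <= 2 and i >= 2m. Its projective dimension is
exactly 3m - 1, and

  4m - 2m + a = 3m - 2  <  3m - 1  <  3m = 4m - 2 - a.

Upper bound. For a monomial ideal I and a variable v there is an exact sequence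
0 -> R/(I : v) -> R/I -> R/(I + v) -> 0 ([mono_quot_exact]). When I is the edge
ideal plus the variables of a set S of vertices, I : v is obtained by adding
to S the neighbours of v, and I + v by adding v to S. As the projective
dimension of an extension is at most the larger of those of its ends
([pdim_le_extension]), one may enlarge S in these two ways until it covers all
edges ([pdim_le_branch]); then the ideal is generated by |S| variables and the
projective dimension is at most |S| ([pdim_le_cover]). Treating the vertices of
layer 1, then those of layer 2, only produces covers with |S| <= 3m - 1.

Lower bound. If M has a projective resolution of length s, its Koszul
cohomology on r > j + s distinct variables vanishes in degree j
([resolution_acyclic]): this holds with s = 0 for free modules and their
retracts, and each step of the resolution shifts the degree by one. In degree 1
the vanishing says that a family c_x of elements of M, with x c_y = y c_x for
all variables x and y among the r chosen ones, has the form c_x = x t for a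
single t ([resolution_compatible]). In M = R/I_G take the 3m variables outside
layer 0, a vertex l of layer 0, and the family c_x = x l for x in layer 2 and
c_x = 0 for x in layers 1 and 3. It is compatible since layer 2 is completely
joined to layers 1 and 3; but t would need l-coefficient 1 because of a vertex
of layer 2, and 0 because of a vertex of layer 3 ([resolution_length_ge]).
So 3m <= s + 1. *)

Set Implicit Arguments.
Unset Strict Implicit.
Unset Printing Implicit Defensive.

Import GRing.Theory.

Local Open Scope ring_scope.

(** * Kernels of linear maps *)

Section Kernel.
Variables (R : pzRingType) (M N : lmodType R) (f : {linear M -> N}).

Definition in_kernel : {pred M} := fun x => f x == 0.

Fact in_kernel_submod_closed : submod_closed in_kernel.
Proof.
split=> [|a x y /eqP fx /eqP fy]; first by rewrite unfold_in linear0.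
by rewrite unfold_in linearP fx fy scaler0 addr0.
Qed.

HB.instance Definition _ :=
  GRing.isSubmodClosed.Build R M in_kernel in_kernel_submod_closed.

Record kernel := Kernel { kernel_val : M; _ : kernel_val \in in_kernel }.

HB.instance Definition _ := [isSub for kernel_val].
HB.instance Definition _ := [Choice of kernel by <:].
HB.instance Definition _ := [SubChoice_isSubLmodule of kernel by <:].

Lemma kernel_valP (x : kernel) : f (val x) = 0.
Proof. by apply/eqP; exact: (valP x). Qed.

Lemma kernel_lift x : f x = 0 -> exists y : kernel, val y = x.
Proof. by move=> /eqP fx; exists (Kernel fx). Qed.

End Kernel.

(** * Short exact sequences and bounds on the projective dimension *)

Section Homological.
Variable R : pzRingType.
Implicit Types A B C K L M N P : lmodType R.

Definition linear_of A B (f : A -> B) (f_lin : linear f) : {linear A -> B} :=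
  HB.pack f (GRing.isLinear.Build R A B _ f f_lin).

Definition surjective A B (f : A -> B) := forall y, exists x, f x = y.

Definition short_exact A B C (i : {linear A -> B}) (g : {linear B -> C}) :=
  [/\ injective i, surjective g & forall b, g b = 0 <-> exists a, i a = b].

Lemma linear_factor A B C (i : {linear A -> B}) (u : {linear C -> B}) :
  injective i -> (forall c, exists a, i a = u c) ->
  exists h : {linear C -> A}, forall c, i (h c) = u c.
Proof.
move=> i_inj /choice[h ihu].
have h_lin : linear h by move=> a x y; apply: i_inj; rewrite linearP !ihu linearP.
by exists (linear_of h_lin).
Qed.

Lemma short_exact_kernel M N (f : {linear M -> N}) :
  surjective f -> short_exact (val : {linear kernel f -> M}) f.
Proof.
move=> f_surj; split=> // [|x]; first exact: val_inj.
by split=> [/kernel_lift//|[y <-]]; exact: kernel_valP.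
Qed.

(** The source of the zero modules beyond the end of a finite resolution. *)
Lemma projective_trivial M : (forall x : M, x = 0) -> projective M.
Proof.
move=> M0 A B g f _; exists (\0 : {linear M -> A}) => x /=.
by rewrite linear0 (M0 x) linear0.
Qed.

(** The sequence splits because [C] is projective: with a section [s] of [g] and
the induced retraction [r] of [i], a map out of [B] is lifted on [A] and on [C]
separately. *)
Lemma projective_extension A B C (i : {linear A -> B}) (g : {linear B -> C}) :
  short_exact i g -> projective A -> projective C -> projective B.
Proof.
move=> [i_inj g_surj ex] pA pC M N q f q_surj.
have [s gs] := pC _ _ g (idfun : {linear C -> C}) g_surj.
have [r ir] : exists r : {linear B -> A}, forall b, i (r b) = b - s (g b).
  pose u : {linear B -> B} := idfun \- (s \o g).
  apply: (linear_factor (u := u)) => // b; apply/ex.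
  by rewrite linearB /= gs subrr.
have [hA qA] := pA _ _ q (f \o i) q_surj.
have [hC qC] := pC _ _ q (f \o s) q_surj.
exists ((hA \o r) \+ (hC \o g)) => b /=.
by rewrite linearD qA qC /= ir -linearD subrK.
Qed.

Lemma pair0_linear A B C (j : {linear A -> B}) :
  linear (fun a => (j a, 0) : (B * C)%type).
Proof.
by move=> c x y; rewrite [RHS]surjective_pairing /= linearP scaler0 addr0.
Qed.

Lemma projective_prod A B : projective A -> projective B ->
  projective ((A * B)%type : lmodType R).
Proof.
move=> pA pB.
pose inl := linear_of (@pair0_linear A A B idfun).
apply: (@projective_extension A _ B inl snd) => //.
split=> [x y [] //|y|[a b]]; first by exists (0, y).
by split=> [/= ->|[? [_ <-]] //]; exists a.
Qed.

(** A finite resolution is unfolded one syzygy at a time, so that bounds can be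
proved by induction on [n] without comparing whole resolutions. The syzygy [K]
is any module with an embedding in [P], which leaves no isomorphism to be
transported. *)
Fixpoint pdim_le n M : Prop :=
  if n is n'.+1 then
    exists K P (i : {linear K -> P}) (g : {linear P -> M}),
      [/\ short_exact i g, projective P & pdim_le n' K]
  else projective M.

Lemma pdim_leS n M : pdim_le n M -> pdim_le n.+1 M.
Proof.
elim: n M => [|n IHn] M pM; last first.
  case: pM => K [P [i [g [ex pP pK]]]].
  by exists K, P, i, g; split=> //; exact: IHn.
(* A projective module covers itself, with zero kernel. *)
exists (kernel (idfun : {linear M -> M})), M, val, idfun; split=> //.
  by apply: short_exact_kernel => x; exists x.
apply: projective_trivial => x; apply: val_inj.
by rewrite linear0; exact: (kernel_valP x).
Qed.

Lemma pdim_leW m n M : (m <= n)%N -> pdim_le m M -> pdim_le n M.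
Proof.
move/subnK<-; elim: (n - m)%N => // d IHd pM.
by rewrite addSn; apply: pdim_leS; exact: IHd.
Qed.

(** The horseshoe argument: covers of [A] and [C] by [PA] and [PC] combine to a
cover of [B] by [PA * PC], after lifting [PC -> C] through [g], and the kernels
of the three covers again form a short exact sequence. *)
Lemma pdim_le_extension n A B C (i : {linear A -> B}) (g : {linear B -> C}) :
  short_exact i g -> pdim_le n A -> pdim_le n C -> pdim_le n B.
Proof.
elim: n A B C i g => [|n IHn] A B C i g ex.
  exact: (projective_extension ex).
move=> /= [KA [PA [jA [qA [exA pPA pKA]]]]] [KC [PC [jC [qC [exC pPC pKC]]]]].
case: (ex) => i_inj g_surj ker_g.
case: (exA) => jA_inj qA_surj ker_qA; case: (exC) => jC_inj qC_surj ker_qC.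
have [l gl] := pPC _ _ g qC g_surj.
pose q : {linear (PA * PC)%type -> B} := ((i \o qA) \o fst) \+ (l \o snd).
have q_surj : surjective q.
  move=> b; have [c qc] := qC_surj (g b).
  have [|a ia] := (ker_g (b - l c)).1; first by rewrite linearB gl qc subrr.
  by have [a' qa] := qA_surj a; exists (a', c); rewrite /q /= qa ia subrK.
exists (kernel q), (PA * PC)%type, val, q; split.
- exact: short_exact_kernel.
- exact: projective_prod.
have [u uE] : exists u : {linear KA -> kernel q}, forall a, val (u a) = (jA a, 0).
  apply: (linear_factor (i := val) (u := linear_of (pair0_linear PC jA))).
    exact: val_inj.
  move=> a; apply: kernel_lift; rewrite /q /= linear0 addr0.
  by rewrite (ker_qA _).2 ?linear0 //; exists a.
have [v vE] : exists v : {linear kernel q -> KC}, forall x, jC (v x) = (val x).2.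
  apply: (linear_factor (u := snd \o val)) => // x; apply/ker_qC.
  have := congr1 g (kernel_valP x); rewrite /q /= linear0 linearD gl /= => <-.
  by rewrite (ker_g _).2 ?add0r //; exists (qA (val x).1).
apply: (IHn KA (kernel q) KC u v) => //; split.
- by move=> x y /(congr1 val); rewrite !uE => -[/jA_inj].
- move=> c.
  have [|a ia] := (ker_g (- l (jC c))).1.
    by rewrite linearN gl (ker_qC _).2 ?oppr0 //; exists c.
  have [a' qa] := qA_surj a.
  have [|x xE] := @kernel_lift _ _ _ q (a', jC c).
    by rewrite /q /= qa ia addNr.
  by exists x; apply: jC_inj; rewrite vE xE.
- move=> x; split=> [vx0|[a <-]]; last first.
    by apply: jC_inj; rewrite vE uE linear0.
  have x2 : (val x).2 = 0 by rewrite -vE vx0 linear0.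
  have [|a ja] := (ker_qA (val x).1).1.
    apply: i_inj; rewrite linear0 -[RHS](kernel_valP x) /q /=.
    by rewrite x2 linear0 addr0.
  by exists a; apply: val_inj; rewrite uE ja -x2; case: (val x).
Qed.

(** Compose a cover [q : P -> B] with [g]: the kernel of [g \o q] is an
extension of [A] by the first syzygy [K] of [B], and is a first syzygy
of [C]. *)
Lemma pdim_le_cokernel n A B C (i : {linear A -> B}) (g : {linear B -> C}) :
  short_exact i g -> pdim_le n A -> pdim_le n.+1 B -> pdim_le n.+1 C.
Proof.
move=> [i_inj g_surj ker_g] pA /= [K [P [j [q [[j_inj q_surj ker_q] pP pK]]]]].
pose p : {linear P -> C} := g \o q.
have p_surj : surjective p.
  by move=> c; have [b <-] := g_surj c; have [x <-] := q_surj b; exists x.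
exists (kernel p), P, val, p; split=> //; first exact: short_exact_kernel.
have [u uE] : exists u : {linear K -> kernel p}, forall a, val (u a) = j a.
  apply: linear_factor => [|a]; first exact: val_inj.
  by apply: kernel_lift; rewrite /p /= (ker_q _).2 ?linear0 //; exists a.
have [v vE] : exists v : {linear kernel p -> A}, forall x, i (v x) = q (val x).
  apply: (linear_factor (u := q \o val)) => // x; apply/ker_g.
  exact: (kernel_valP x).
apply: (pdim_le_extension (i := u) (g := v)) => //; split.
- by move=> x y /(congr1 val); rewrite !uE => /j_inj.
- move=> a; have [x qx] := q_surj (i a).
  have [|y yE] := @kernel_lift _ _ _ p x.
    by rewrite /p /= qx; apply/ker_g; exists a.
  by exists y; apply: i_inj; rewrite vE yE.
- move=> x; split=> [vx0|[a <-]]; last first.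
    by apply: i_inj; rewrite vE uE linear0; apply/ker_q; exists a.
  have [|a ja] := (ker_q (val x)).1; first by rewrite -vE vx0 linear0.
  by exists a; apply: val_inj; rewrite uE.
Qed.

Lemma pdim_le_resolution n M : pdim_le n M -> has_resolution_le M n.
Proof.
elim: n M => [|n IHn] M.
  move=> pM; pose Z : lmodType R := kernel (idfun : {linear M -> M}).
  have Z0 (z : Z) : z = 0.
    by apply: val_inj; rewrite linear0; exact: (kernel_valP z).
  pose Q i : lmodType R := if i is _.+1 then Z else M.
  have Q0 i (x : Q i.+1) : x = 0 by exact: Z0.
  unshelve eexists.
    apply: (@ProjectiveResolution R M Q (fun i => \0 : {linear Q i.+1 -> Q i})
              (idfun : {linear M -> M})).
    - by case=> // i; apply: projective_trivial; exact: Q0.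
    - by move=> y; exists y.
    - by move=> x; split=> [/= ->|[z <-] //]; exists 0.
    - by move=> i x; split=> [_|//]; exists 0; rewrite (Q0 _ x).
  by case=> // i _ x; exact: Q0.
case=> K [P [j [g [[j_inj g_surj ker_g] pP /IHn[T lenT]]]]].
pose Q i : lmodType R := if i is i'.+1 then res_mod T i' else P.
pose dif i : {linear Q i.+1 -> Q i} :=
  match i return {linear Q i.+1 -> Q i} with
  | 0 => j \o res_aug T
  | i'.+1 => res_dif T i'
  end.
unshelve eexists.
  apply: (@ProjectiveResolution R M Q dif g) => //.
  - by case=> // i; exact: res_proj.
  - move=> x; rewrite ker_g; split=> [[a <-]|[z <-]]; last by eexists.
    by have [z <-] := res_aug_surj T a; exists z.
  - case=> [|i] x; last exact: res_exact.
    rewrite /= -res_exact0; split=> [|->]; last exact: linear0.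
    by rewrite -(linear0 j) => /j_inj.
by case=> // i; exact: lenT.
Qed.

(** Only the augmentation of the resolution changes. *)
Lemma has_resolution_le_iso M N (f : {linear M -> N}) n :
  bijective f -> has_resolution_le M n -> has_resolution_le N n.
Proof.
move=> [f' fK f'K] [T lenT].
unshelve eexists.
  apply: (@ProjectiveResolution R N (res_mod T) (res_dif T) (f \o res_aug T)).
  - exact: res_proj.
  - by move=> y; have [x xE] := res_aug_surj T (f' y); exists x; rewrite /= xE.
  - move=> x; rewrite -res_exact0 /=; split=> [|->]; last exact: linear0.
    by rewrite -(linear0 f) => /(can_inj fK).
  - exact: res_exact.
exact: lenT.
Qed.

End Homological.

(** * Koszul cohomology *)

Section Koszul.
Variable R : comNzRingType.
Implicit Types (V W : lmodType R) (x : R) (xs : seq R) (w : seq bool).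

(** Words of length [n] with [j] letters [true] index the basis of the [j]-th
exterior power of a free module of rank [n]. *)
Definition word n j w := (size w == n) && (count id w == j).

(** The Koszul differential, seen as an iterated mapping cone: a cochain on
[x :: xs] is a pair of cochains on [xs], its values on words starting with
[false] and with [true]. A single function carries the cochains of all degrees;
the differential at a word with [j.+1] letters [true] only involves values at
words with [j] of them. *)
Fixpoint koszul V xs (u : seq bool -> V) w : V :=
  match xs, w with
  | x :: xs', true :: w' =>
      x *: u (false :: w') - koszul xs' (fun s => u (true :: s)) w'
  | _ :: xs', false :: w' => koszul xs' (fun s => u (false :: s)) w'
  | _, _ => 0
  end.

Definition koszul_acyclic V xs j :=
  forall u : seq bool -> V,
    (forall w, word (size xs) j.+1 w -> koszul xs u w = 0) ->
    exists v, forall w, word (size xs) j w -> u w = koszul xs v w.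

Lemma koszul_word0 V xs (u : seq bool -> V) w :
  count id w = 0%N -> koszul xs u w = 0.
Proof. by elim: xs u w => [|x xs IHx] u [|[] w] //= w0; apply: IHx. Qed.

Lemma eq_koszul V xs j (u v : seq bool -> V) :
  (forall w, word (size xs) j w -> u w = v w) ->
  forall w, word (size xs) j.+1 w -> koszul xs u w = koszul xs v w.
Proof.
elim: xs j u v => [|x xs IHx] j u v eq_uv [|[] w] //=; rewrite /word /= eqSS.
- rewrite add1n eqSS => jw; rewrite eq_uv /word /= ?eqSS ?add0n //.
  congr (_ - _); case: j eq_uv jw => [|j] eq_uv jw.
    by case/andP: jw => _ /eqP w0; rewrite !koszul_word0.
  by apply: IHx jw => s js; apply: eq_uv; rewrite /word /= eqSS add1n eqSS.
- rewrite add0n => jw; apply: IHx jw => s js.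
  by apply: eq_uv; rewrite /word /= eqSS add0n.
Qed.

Lemma koszul_map V W (f : {additive V -> W}) xs (u : seq bool -> V) w :
    {in xs, forall x v, f (x *: v) = x *: f v} ->
  koszul xs (f \o u) w = f (koszul xs u w).
Proof.
elim: xs u w => [|x xs IHx] u [|[] w] //= fxs; rewrite ?raddf0 //.
  rewrite raddfB /= fxs ?mem_head // -IHx // => y ys v.
  by rewrite fxs // mem_behead.
by rewrite -IHx // => y ys v; rewrite fxs // mem_behead.
Qed.

Lemma koszulB V xs (u v : seq bool -> V) w :
  koszul xs (fun s => u s - v s) w = koszul xs u w - koszul xs v w.
Proof.
elim: xs u v w => [|x xs IHx] u v [|[] w] /=; rewrite ?subrr //.
  by rewrite IHx scalerBr !opprD !opprK addrACA.
Qed.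

Lemma koszulZ V xs x (u : seq bool -> V) w :
  koszul xs (fun s => x *: u s) w = x *: koszul xs u w.
Proof.
by rewrite -koszul_map // => y _ v; rewrite /= !scalerA mulrC.
Qed.

Lemma koszulK V xs (u : seq bool -> V) w : koszul xs (koszul xs u) w = 0.
Proof.
elim: xs u w => [|x xs IHx] u [|[] w] //=.
by rewrite koszulB koszulZ IHx subr0 subrr.
Qed.

(** In degree 1 a word has a single letter [true]; this is the ring element at
its position. *)
Definition direction xs w := nth 0 xs (index true w).

Lemma koszul_word1 V xs (v : seq bool -> V) w : word (size xs) 1 w ->
  direction xs w \in xs /\
  koszul xs v w = direction xs w *: v (nseq (size xs) false).
Proof.
elim: xs v w => [|x xs IHx] v [|[] w] //; rewrite /word /= eqSS.
  rewrite add1n eqSS => /andP[/eqP <- /eqP w0].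
  have wE : nseq (size w) false = w.
    by elim: w w0 => [|[] w IHw] //= /IHw ->.
  by rewrite /direction /= koszul_word0 // subr0 mem_head wE.
rewrite add0n => w1; have [xw kw] := IHx (fun s => v (false :: s)) w w1.
by split; [rewrite in_cons [X in _ || X]xw orbT | exact: kw].
Qed.

Lemma koszul_word2 V xs (c : R -> V) w :
    {in xs &, forall x y, x *: c y = y *: c x} ->
  word (size xs) 2 w -> koszul xs (fun s => c (direction xs s)) w = 0.
Proof.
elim: xs w => [|x xs IHx] [|[] w] // cxs; rewrite /word /= eqSS.
  rewrite add1n eqSS => w1; have [xw ->] := koszul_word1 (fun=> c x) w1.
  have xw' : direction xs w \in x :: xs by rewrite in_cons xw orbT.
  by apply/eqP; rewrite subr_eq0; apply/eqP/(cxs x _ (mem_head _ _) xw').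
rewrite add0n => w2; apply: IHx => // y z yxs zxs.
by apply: cxs; rewrite in_cons ?yxs ?zxs orbT.
Qed.

(** A strong form of regularity of a sequence that is inherited by arbitrary
direct sums: each [x] can be divided out by an additive operator which is
linear over the later elements. For variables of a polynomial ring the operator
forgets the monomials without [x] and divides the others by [x]. *)
Fixpoint peelable V xs : Prop :=
  if xs is x :: xs' then
    (exists D : {additive V -> V}, cancel ( *:%R x) D /\
       {in xs', forall y v, D (y *: v) = y *: D v})
    /\ peelable V xs'
  else True.

(** Write a cocycle as [(u0, u1)]. The cocycle condition says that [x u0 = d u1]
and [d u0 = 0]. Applying [D] gives [u0 = d (D u1)], and then
[x (D u1) - u1] is a cocycle in one degree less on the shorter sequence, hence
a coboundary [d v1]; so [(u0, u1)] is the coboundary of [(D u1, v1)]. *)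
Lemma peelable_acyclic V xs j :
  peelable V xs -> (j < size xs)%N -> koszul_acyclic V xs j.
Proof.
elim: xs j => [|x xs IHx] j //= [[D [DK Dxs]] pV] lt_j u du0.
pose u0 s := u (false :: s); pose u1 s := u (true :: s).
have xu0 s : word (size xs) j s -> x *: u0 s = koszul xs u1 s.
  move=> js; apply/eqP; rewrite -subr_eq0; apply/eqP.
  by apply: (du0 (true :: s)); rewrite /word /= eqSS add1n eqSS.
have u0E s : word (size xs) j s -> u0 s = koszul xs (D \o u1) s.
  by move=> js; rewrite koszul_map // -xu0 // DK.
have [v1 v1E] : exists v1, forall s, word (size xs).+1 j (true :: s) ->
    koszul xs v1 s = x *: D (u1 s) - u1 s.
  (* In degree 0 no word of the right weight starts with [true]. *)
  case: j lt_j xu0 {du0 u0E} => [|j] lt_j xu0.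
    by exists (fun=> 0) => s /andP[].
  have [|v1 v1E] := IHx j pV lt_j (fun s => x *: D (u1 s) - u1 s).
    move=> s js; rewrite koszulB koszulZ (koszul_map (f := D)) //.
    by rewrite -xu0 // DK subrr.
  exists v1 => s; rewrite /word /= eqSS add1n eqSS => js; exact/esym/v1E.
exists (fun s => if s is false :: s' then D (u1 s') else v1 (behead s)).
case=> [//|[] s] js /=; first by rewrite v1E // opprB addrC subrK.
by rewrite -[LHS]/(u0 s) u0E //; move: js; rewrite /word /= eqSS add0n.
Qed.

Lemma acyclic_retract V W (f : {linear V -> W}) (h : {linear W -> V}) xs j :
  cancel h f -> koszul_acyclic V xs j -> koszul_acyclic W xs j.
Proof.
move=> hK acV u du0.
have [w jw|v vE] := acV (h \o u).
  by rewrite (koszul_map (f := h)) ?du0 ?raddf0 // => x _ y; exact: linearZ.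
exists (f \o v) => w jw; rewrite (koszul_map (f := f)); last first.
  by move=> x _ y; exact: linearZ.
by rewrite -vE //= hK.
Qed.

(** The operators of [R] act on the coefficients. *)
Lemma peelable_free (K : choiceType) xs :
  peelable R^o xs -> peelable {freeg K / R} xs.
Proof.
elim: xs => //= x xs IHx [[D [DK Dxs]] pR]; split; last exact: IHx.
pose F (z : {freeg K / R}) : {freeg K / R} :=
  \sum_(y <- dom z) << (D (coeff y z) : R) *g y >>.
have coeffF y z : coeff y (F z) = D (coeff y z).
  rewrite -{2}(freeg_sumE z) /F !raddf_sum /=; apply: eq_bigr => t _.
  by rewrite !coeffU; case: (_ == _); rewrite ?mulr1 // !mulr0 raddf0.
have F_add : zmod_morphism F.
  move=> a b; apply/eqP/freeg_eqP => y.
  by rewrite coeffB !coeffF coeffB raddfB.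
pose FA : {additive {freeg K / R} -> {freeg K / R}} :=
  HB.pack F (GRing.isZmodMorphism.Build _ _ F F_add).
exists FA; split=> [v|y yxs v]; apply/eqP/freeg_eqP => t.
  by rewrite /= coeffF coeffZ; exact: DK.
by rewrite /= coeffF !coeffZ coeffF; exact: Dxs.
Qed.

Lemma fglift_linear (K : choiceType) V (f : K -> V) : linear (fglift f).
Proof.
pose g : {additive {freeg K / R} -> V} :=
  HB.pack (fglift f) (GRing.isZmodMorphism.Build _ _ _ (lift_is_additive f)).
have gZ c z : g (c *: z) = c *: g z.
  rewrite -[z in RHS]freeg_sumE -[c *: z]/(fgscale c z) /fgscale !raddf_sum.
  by apply: eq_bigr => t _; rewrite /= !liftU scalerA.
by move=> c y z; rewrite -[LHS]/(g _) raddfD gZ.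
Qed.

(** A projective module is a retract of the free module on its elements. *)
Lemma projective_acyclic (P : lmodType R) xs j : peelable R^o xs ->
  projective P -> (j < size xs)%N -> koszul_acyclic P xs j.
Proof.
move=> pR pP lt_j.
pose F : lmodType R := {freeg P / R}.
pose f : {linear F -> P} := linear_of (fglift_linear (fun p : P => p)).
have f_surj : surjective f.
  by move=> p; exists << p >>; rewrite [LHS]liftU scale1r.
have [h hE] := pP _ _ f (idfun : {linear P -> P}) f_surj.
apply: (acyclic_retract (f := f) (h := h) hE).
exact: peelable_acyclic (peelable_free P pR) lt_j.
Qed.

(** Vanishing in degree [j] for the [i]-th syzygy of [M], the image of
[res_dif T i] being divided out of [res_mod T i]. Here [d] is the number of
steps before the resolution is zero. Lifting a cocycle modulo the image gives a
cocycle of degree [j.+1] for the next syzygy, where the induction applies; what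
remains is a true cocycle with values in the projective module
[res_mod T i]. *)
Lemma syzygy_acyclic (M : lmodType R) (T : projective_resolution M) s xs :
    peelable R^o xs -> res_length_le T s ->
  forall d i j, (i + d = s.+1)%N -> (j + d <= size xs)%N ->
  forall u : seq bool -> res_mod T i,
    (forall w, word (size xs) j.+1 w ->
       exists z, res_dif T i z = koszul xs u w) ->
    exists v, forall w, word (size xs) j w ->
       exists z, res_dif T i z = u w - koszul xs v w.
Proof.
move=> pR lenT; elim=> [|d IHd] i j eq_i le_j u du.
  exists (fun=> 0) => w _; exists 0.
  by rewrite linear0; apply/esym/lenT; rewrite -eq_i addn0.
have /choice[t tE] w : exists z,
    word (size xs) j.+1 w -> res_dif T i z = koszul xs u w.
  have [jw|] := boolP (word _ _ w); last by exists 0.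
  by have [z zE] := du w jw; exists z.
have linK : {in xs, forall x v, res_dif T i (x *: v) = x *: res_dif T i v}.
  by move=> x _ v; exact: linearZ.
rewrite -addSnnS in eq_i; have le_Sj : (j.+1 + d <= size xs)%N by rewrite addSnnS.
have [|v vE] := IHd i.+1 j.+1 eq_i le_Sj t.
  move=> w jw; apply/res_exact; rewrite -koszul_map //.
  rewrite (eq_koszul (v := koszul xs u) (j := j.+1)) ?koszulK //.
have lt_j : (j < size xs)%N by apply: leq_trans le_j; rewrite addnS ltnS leq_addr.
have [w jw|v' v'E] := projective_acyclic pR (@res_proj _ _ T i) lt_j
    (u := fun w => u w - res_dif T i (v w)).
  rewrite koszulB -tE // (koszul_map (f := res_dif T i)) //.
  rewrite -linearB; apply/res_exact; exact: vE.
exists v' => w jw; exists (v w); rewrite -v'E //.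
by rewrite opprB addrC subrK.
Qed.

Lemma resolution_acyclic (M : lmodType R) s xs j :
    peelable R^o xs -> has_resolution_le M s -> (j + s < size xs)%N ->
  koszul_acyclic M xs j.
Proof.
move=> pR [T lenT] lt_j u du.
have /choice[t tE] w := res_aug_surj T (u w).
have linK : {in xs, forall x v, res_aug T (x *: v) = x *: res_aug T v}.
  by move=> x _ v; exact: linearZ.
rewrite -addnS in lt_j.
have [w jw|v vE] := syzygy_acyclic pR lenT (add0n s.+1) lt_j (u := t).
  apply/res_exact0; rewrite -koszul_map // -(du w jw).
  by apply: (eq_koszul _ jw) => w' _; exact: tE.
exists (res_aug T \o v) => w jw; rewrite koszul_map // -tE.
by apply/eqP; rewrite -subr_eq0 -linearB; apply/eqP/res_exact0/vE.
Qed.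

(** The degree 1 case: a compatible family is a cocycle, and a cochain of
degree 0 is a single element of [M]. *)
Lemma resolution_compatible (M : lmodType R) s xs (c : R -> M) :
    peelable R^o xs -> has_resolution_le M s -> (s.+1 < size xs)%N ->
    {in xs &, forall x y, x *: c y = y *: c x} ->
  exists v, {in xs, forall x, c x = x *: v}.
Proof.
move=> pR resM lt_s cxs.
have [w w2|v vE] := resolution_acyclic pR resM (j := 1) lt_s
    (u := fun w => c (direction xs w)).
  exact: koszul_word2.
exists (v (nseq (size xs) false)) => x xxs.
(* The word whose only letter [true] is at the position of [x]. *)
pose w := nseq (index x xs) false
  ++ true :: nseq (size xs - (index x xs).+1) false.
have w1 : word (size xs) 1 w.
  rewrite /word size_cat /= !size_nseq count_cat /= !count_nseq !mul0n addnS.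
  by rewrite -addSn subnKC ?index_mem // !eqxx.
have dw : direction xs w = x.
  by rewrite /direction index_cat mem_nseq andbF /= size_nseq addn0 nth_index.
by have := vE _ w1; rewrite (koszul_word1 v w1).2 dw.
Qed.

End Koszul.

(** * Quotients of modules *)

Section ModuleQuotient.
Variables (R : pzRingType) (M : lmodType R) (S : submodClosed M).

(** Scaling by -1 gives the closure under subtraction that a quotient needs. *)
Definition submodule_pred : {pred M} := fun x => x \in S.

Fact submodule_zmod_closed : zmod_closed submodule_pred.
Proof.
split=> [|x y xS yS]; first exact: rpred0.
by rewrite -scaleN1r; apply: rpredD => //; exact: rpredZ.
Qed.

HB.instance Definition _ :=
  GRing.isZmodClosed.Build M submodule_pred submodule_zmod_closed.

Definition mquot : Type := Quotient.quot submodule_pred.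
HB.instance Definition _ := GRing.Zmodule.on mquot.
HB.instance Definition _ := EqQuotient.on mquot.

Definition mquot_pi (x : M) : mquot := (\pi_mquot x)%qT.

Lemma mquot_piP x y : mquot_pi x = mquot_pi y <-> x - y \in S.
Proof.
by rewrite -[_ \in S]/(_ \in submodule_pred) Quotient.idealrBE; split=> /eqP.
Qed.

Lemma mquot_pi_surj u : exists x, mquot_pi x = u.
Proof. by exists (repr u); exact: reprK. Qed.

Definition mquot_scale a (u : mquot) : mquot := mquot_pi (a *: repr u).

Lemma mquot_scaleE a x : mquot_scale a (mquot_pi x) = mquot_pi (a *: x).
Proof.
apply/mquot_piP; rewrite -scalerBr rpredZ //; exact/mquot_piP/reprK.
Qed.

Lemma mquot_piD x y : mquot_pi (x + y) = mquot_pi x + mquot_pi y.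
Proof. exact: Quotient.pi_add. Qed.

Fact mquot_scaleA a b u : mquot_scale a (mquot_scale b u) = mquot_scale (a * b) u.
Proof. by have [x <-] := mquot_pi_surj u; rewrite !mquot_scaleE scalerA. Qed.

Fact mquot_scale1 : left_id 1 mquot_scale.
Proof.
by move=> u; have [x <-] := mquot_pi_surj u; rewrite mquot_scaleE scale1r.
Qed.

Fact mquot_scaleDr : right_distributive mquot_scale +%R.
Proof.
move=> a u v; have [x <-] := mquot_pi_surj u; have [y <-] := mquot_pi_surj v.
by rewrite -mquot_piD !mquot_scaleE scalerDr mquot_piD.
Qed.

Fact mquot_scaleDl u : {morph mquot_scale^~ u : a b / a + b}.
Proof.
move=> a b; have [x <-] := mquot_pi_surj u.
by rewrite !mquot_scaleE scalerDl mquot_piD.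
Qed.

HB.instance Definition _ := GRing.Zmodule_isLmodule.Build R mquot
  mquot_scaleA mquot_scale1 mquot_scaleDr mquot_scaleDl.

Lemma mquot_pi_linear : linear mquot_pi.
Proof. by move=> a x y; rewrite mquot_piD -mquot_scaleE. Qed.

Lemma mquot_pi_eq0 x : mquot_pi x = 0 <-> x \in S.
Proof.
have <- : mquot_pi 0 = 0.
  by apply: (addrI (mquot_pi 0)); rewrite -mquot_piD !addr0.
by rewrite mquot_piP subr0.
Qed.

Lemma mquot_lift (N : lmodType R) (f : {linear M -> N}) :
  {in S, forall x, f x = 0} ->
  exists g : {linear mquot -> N}, forall x, g (mquot_pi x) = f x.
Proof.
move=> fS; pose g (u : mquot) := f (repr u).
have gE x : g (mquot_pi x) = f x.
  apply/eqP; rewrite -subr_eq0 -linearB; apply/eqP/fS/mquot_piP; exact: reprK.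
have g_lin : linear g.
  move=> a u v; have [x <-] := mquot_pi_surj u; have [y <-] := mquot_pi_surj v.
  by rewrite -mquot_pi_linear !gE linearP.
by exists (linear_of g_lin).
Qed.

End ModuleQuotient.

(** * Monomial ideals *)

Section Monomials.
Variables (k : comNzRingType) (n : nat).
Implicit Types (p q : {mpoly k[n]}) (m : 'X_{1..n}) (i : 'I_n).

Lemma mcoeffMXU i p m : ('X_i * p)@_(m + U_(i)) = p@_m.
Proof. by rewrite addmC -commr_mpolyX mcoeffMX. Qed.

Lemma mcoeffMXU0 i p m : m i = 0%N -> ('X_i * p)@_m = 0.
Proof.
move=> mi0; rewrite [p in LHS]mpolyE mulr_sumr !raddf_sum /= big1 // => m' _.
rewrite -scalerAr -mpolyXD mcoeffZ mcoeffX.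
case: eqP => [e|]; last by rewrite mulr0.
by move: mi0; rewrite -e mnmDE mnm1E eqxx.
Qed.

Definition divX i p : {mpoly k[n]} :=
  \sum_(m <- msupp p | (0 < m i)%N) p@_m *: 'X_[m - U_(i)].

Lemma subm1K i m : (0 < m i)%N -> (m - U_(i) + U_(i))%MM = m.
Proof. by move=> mi; rewrite submK // lep1mP -lt0n. Qed.

Lemma mcoeff_divX i p m : (divX i p)@_m = p@_(m + U_(i)).
Proof.
rewrite raddf_sum /= [in RHS](mpolyE p) raddf_sum /= big_mkcond.
apply: eq_bigr => m' _; rewrite !mcoeffZ mcoeffX.
case: posnP => [m'i|m'i]; rewrite mcoeffX.
  case: eqP => [e|]; last by rewrite mulr0.
  by move: m'i; rewrite e mnmDE mnm1E eqxx addn1.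
by rewrite -(eqm_add2r U_(i)) subm1K.
Qed.

Lemma divX_additive i : zmod_morphism (divX i).
Proof.
by move=> p q; apply/mpolyP => m; rewrite mcoeffB !mcoeff_divX mcoeffB.
Qed.

Lemma divXK i : cancel ( *%R 'X_i) (divX i).
Proof. by move=> p; apply/mpolyP => m; rewrite mcoeff_divX mcoeffMXU. Qed.

Lemma divX_comm i j p : j != i -> divX i ('X_j * p) = 'X_j * divX i p.
Proof.
move=> ne_ji; apply/mpolyP => m; rewrite mcoeff_divX.
have [mj0|mj] := posnP (m j).
  by rewrite !mcoeffMXU0 // mnmDE mnm1E mj0 eq_sym (negPf ne_ji).
rewrite -(subm1K mj) -!addmA [(U_(j) + _)%MM]addmC addmA !mcoeffMXU.
by rewrite mcoeff_divX.
Qed.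

Lemma variables_peelable (s : seq 'I_n) : uniq s ->
  peelable ({mpoly k[n]} : comNzRingType)^o [seq 'X_i | i <- s].
Proof.
elim: s => //= i s IHs /andP[is' us]; split; last exact: IHs.
pose D : {additive {mpoly k[n]}^o -> {mpoly k[n]}^o} :=
  HB.pack (divX i) (GRing.isZmodMorphism.Build _ _ _ (divX_additive i)).
exists D; split=> [p|_ /mapP[j js ->] p]; first exact: divXK.
by apply: divX_comm; apply: contraNneq is' => <-.
Qed.

(** The monomials of a monomial ideal: they determine it, and form a set that
is stable under multiplication by monomials. *)
Record monoset := Monoset {
  mono :> pred 'X_{1..n};
  monoD : forall m m', mono m -> mono (m + m')%MM }.

Definition mono_ideal (B : monoset) : {pred {mpoly k[n]}^o} :=
  fun p => all B (msupp p).

Lemma mono_idealP (B : monoset) p :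
  reflect (forall m, p@_m != 0 -> B m) (p \in mono_ideal B).
Proof.
apply: (iffP allP) => pB m; first by rewrite -mcoeff_msupp; exact: pB.
by rewrite mcoeff_msupp; exact: pB.
Qed.

Fact mono_ideal_submod_closed B : submod_closed (mono_ideal B).
Proof.
split=> [|a p q /mono_idealP pB /mono_idealP qB]; apply/mono_idealP => m.
  by rewrite mcoeff0 eqxx.
rewrite -mcoeff_msupp => /msuppD_le; rewrite mem_cat => /orP[|].
  move=> /msuppM_le /allpairsP[[m1 m2] /= [_ + ->]].
  by rewrite mcoeff_msupp addmC => /pB; exact: monoD.
by rewrite mcoeff_msupp; exact: qB.
Qed.

HB.instance Definition _ B := GRing.isSubmodClosed.Build
  {mpoly k[n]} {mpoly k[n]}^o (mono_ideal B) (mono_ideal_submod_closed B).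

Definition mono_quot B : lmodType {mpoly k[n]} := mquot (mono_ideal B).

End Monomials.

Section MonoQuot.
Variables (k : comNzRingType) (n : nat).
Implicit Types (p q : {mpoly k[n]}) (m : 'X_{1..n}) (i : 'I_n) (B : monoset n).

Local Notation quot B := (mono_quot k B).

(** The ideal is zero, so the quotient is free on the class of 1. *)
Lemma mono_quot_projective B :
  (forall m, ~~ B m) -> projective (quot B).
Proof.
move=> B0 M N g f g_surj; have [y yE] := g_surj (f (mquot_pi _ 1)).
have f_lin : linear (fun p : {mpoly k[n]}^o => (p : {mpoly k[n]}) *: y).
  by move=> a p q; rewrite scalerDl scalerA.
have [p /mono_idealP pB|h hE] :=
    mquot_lift (f := linear_of f_lin) (S := mono_ideal B).
  suff -> : p = 0 by rewrite linear0.
  apply/mpolyP => m; rewrite mcoeff0; apply/eqP/negPn/negP => /pB.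
  by rewrite (negPf (B0 m)).
exists h => u; have [p <-] := mquot_pi_surj u.
by rewrite hE linearZ yE -linearZ /= -[in RHS](mulr1 p) -mquot_scaleE.
Qed.

(** The sequence 0 -> R/(I : X_i) -> R/I -> R/(I + X_i) -> 0, whose first map is
multiplication by X_i. A monomial is in I : X_i when its product with X_i
is in I, and in I + X_i when it is in I or divisible by X_i. *)
Lemma mono_quot_exact B1 B B2 i :
    (forall m, B1 m = B (m + U_(i))%MM) ->
    (forall m, B2 m = B m || (0 < m i)%N) ->
  exists (f : {linear quot B1 -> quot B}) (g : {linear quot B -> quot B2}),
    short_exact f g.
Proof.
move=> B1E B2E.
have mulX_in p : ('X_i * p \in mono_ideal B) = (p \in mono_ideal B1).
  apply/mono_idealP/mono_idealP => pB m.
    by rewrite B1E -(mcoeffMXU i); exact: pB.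
  have [mi0|mi] := posnP (m i); first by rewrite mcoeffMXU0 ?eqxx.
  by rewrite -(subm1K mi) mcoeffMXU -B1E; exact: pB.
have mul_lin :
    linear (fun p : {mpoly k[n]}^o => mquot_pi (mono_ideal B) ('X_i * p)).
  by move=> a p q; rewrite mulrDr mulrCA; exact: mquot_pi_linear.
have [p pB1|f fE] := mquot_lift (f := linear_of mul_lin) (S := mono_ideal B1).
  by apply/mquot_pi_eq0; rewrite mulX_in.
pose pi2 : {linear {mpoly k[n]}^o -> quot B2} :=
  linear_of (@mquot_pi_linear _ _ (mono_ideal B2)).
have [p /mono_idealP pB|g gE] := mquot_lift (f := pi2) (S := mono_ideal B).
  apply/mquot_pi_eq0/mono_idealP => m /pB.
  by rewrite B2E => ->.
exists f, g; split.
- move=> u v; have [p <-] := mquot_pi_surj u; have [q <-] := mquot_pi_surj v.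
  rewrite !fE => /mquot_piP; rewrite -mulrBr mulX_in => pq.
  exact/mquot_piP.
- move=> v; have [p <-] := mquot_pi_surj v.
  by exists (mquot_pi (mono_ideal B) p); rewrite gE.
- move=> u; split.
    have [p <-] := mquot_pi_surj u; rewrite gE => /mquot_pi_eq0/mono_idealP=> pB2.
    (* [p - X_i * divX i p] is the part of [p] that does not involve X_i. *)
    exists (mquot_pi (mono_ideal B1) (divX i p)).
    rewrite fE; apply/mquot_piP/mono_idealP => m.
    rewrite mcoeffB; have [mi0|mi] := posnP (m i).
      rewrite mcoeffMXU0 // sub0r oppr_eq0 => /pB2.
      by rewrite B2E mi0 orbF.
    by rewrite -(subm1K mi) mcoeffMXU mcoeff_divX subrr eqxx.
  case=> v <-; have [q <-] := mquot_pi_surj v; rewrite fE gE.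
  apply/mquot_pi_eq0/mono_idealP => m.
  rewrite B2E; have [mi0|mi] := posnP (m i); last by rewrite orbT.
  by rewrite mcoeffMXU0 ?eqxx.
Qed.

End MonoQuot.

(** * Edge ideals with some vertices added *)

Section Graph.
Variables (k : fieldType) (G : sgraph).
Implicit Types (S W Y : {set G}) (e : rel G) (x y z v : G) (m : 'X_{1..#|G|}).

Local Notation "m .[ x ]" := (m (enum_rank x)).

(** The monomials of the ideal generated by the vertices of [S] and by the
products of the pairs related by [e]. *)
Definition touches S (e : rel G) m :=
  [exists x in S, (0 < m.[x])%N]
  || [exists x, exists y, [&& e x y, (0 < m.[x])%N & (0 < m.[y])%N]].

Lemma touchesP S e m :
  reflect ((exists2 x, x \in S & (0 < m.[x])%N) \/
           exists x y, [/\ e x y, (0 < m.[x])%N & (0 < m.[y])%N])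
          (touches S e m).
Proof.
apply: (iffP orP) => -[].
- by case/exists_inP=> x xS mx; left; exists x.
- by case/existsP=> x /existsP[y /and3P[exy mx my]]; right; exists x, y.
- by case=> x xS mx; left; apply/exists_inP; exists x.
- case=> x [y [exy mx my]]; right; apply/existsP; exists x; apply/existsP.
  by exists y; rewrite exy mx.
Qed.

Lemma touchesD S e m m' : touches S e m -> touches S e (m + m')%MM.
Proof.
move=> /touchesP t; apply/touchesP; case: t => [[x xS mx]|[x [y [exy mx my]]]].
  by left; exists x => //; rewrite mnmDE ltn_addr.
by right; exists x, y; rewrite !mnmDE !ltn_addr.
Qed.

Definition graph_mono S e : monoset #|G| := Monoset (@touchesD S e).

Local Notation quot S e := (mono_quot k (graph_mono S e)).

Lemma mulU_gt0 m v x :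
  (0 < (m + U_(enum_rank v))%MM (enum_rank x))%N = (0 < m.[x])%N || (x == v).
Proof.
rewrite mnmDE mnm1E addn_gt0 (inj_eq enum_rank_inj) eq_sym.
by case: (x == v).
Qed.

Lemma touchesU1 v S e m : touches (v |: S) e m = touches S e m || (0 < m.[v])%N.
Proof.
apply/touchesP/orP => [[[x /setU1P[->|xS] mx]|t]|[/touchesP[[x xS mx]|t]|mv]].
- by right.
- by left; apply/touchesP; left; exists x.
- by left; apply/touchesP; right.
- by left; exists x => //; rewrite setU1r.
- by right.
- by left; exists v => //; rewrite setU11.
Qed.

(** Multiplying a monomial by v can only create the edges from v to the
neighbours of v that already divide it. *)
Lemma touches_colon v S m : v \notin S ->
  touches S (@adj G) (m + U_(enum_rank v))%MM
    = touches (S :|: [set y | adj v y]) (@adj G) m.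
Proof.
move=> vS; apply/touchesP/touchesP => -[].
- case=> x xS; rewrite mulU_gt0 => /orP[mx|/eqP xv]; last by rewrite -xv xS in vS.
  by left; exists x => //; rewrite inE xS.
- case=> x [y [axy]]; rewrite !mulU_gt0 => /orP[mx|/eqP xv] /orP[my|/eqP yv].
  + by right; exists x, y.
  + by left; exists x; rewrite // !inE -yv adj_sym axy orbT.
  + by left; exists y; rewrite // !inE -xv axy orbT.
  + by rewrite xv yv adj_irr in axy.
- case=> x; rewrite !inE => /orP[xS|avx] mx.
    by left; exists x; rewrite // mulU_gt0 mx.
  by right; exists v, x; rewrite !mulU_gt0 mx eqxx orbT.
- by case=> x [y [axy mx my]]; right; exists x, y; rewrite !mulU_gt0 mx my.
Qed.

(** When [S] covers all pairs, the pairs contribute nothing and the ideal is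
generated by the variables of [S], which are divided out one at a time: X_v is
injective modulo the others, and its cokernel costs one step. *)
Lemma pdim_le_cover S e : (forall x y, e x y -> (x \in S) || (y \in S)) ->
  pdim_le #|S| (quot S e).
Proof.
move=> cover.
pose no : rel G := fun _ _ => false.
have pdim_vars (T : {set G}) : pdim_le #|T| (quot T no).
  move cT: #|T| => d; elim: d T cT => [|d IHd] T cT.
    rewrite (cards0_eq cT); apply: mono_quot_projective => m.
    by apply/touchesP => -[[x]|[x [y []]]] //; rewrite inE.
  have /card_gt0P[v vT] : (0 < #|T|)%N by rewrite cT.
  have cT' : #|T :\ v| = d by move: cT; rewrite (cardsD1 v) vT => -[].
  have [m|m|f [g ex]] := @mono_quot_exact k _ (graph_mono (T :\ v) no)
      (graph_mono (T :\ v) no) (graph_mono T no) (enum_rank v).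
  - apply/touchesP/touchesP => -[[x xT mx]|[x [y []]]] //; left; exists x => //.
      by rewrite mulU_gt0 mx.
    by move: mx; rewrite mulU_gt0 => /orP[//|/eqP xv]; rewrite xv !inE eqxx in xT.
  - by rewrite -[T in LHS](setD1K vT); exact: touchesU1.
  - by apply: pdim_le_cokernel ex _ _; [|apply: pdim_leS]; exact: IHd.
have -> // : graph_mono S e = graph_mono S no.
have E : touches S e = touches S no.
  apply/funext => m; apply/touchesP/touchesP => -[t|[x [y [// exy mx my]]]];
    try by left.
  by left; case/orP: (cover x y exy) => ?; [exists x | exists y].
rewrite /graph_mono; move: (@touchesD S e); rewrite E => t.
by congr Monoset; exact: Prop_irrelevance.
Qed.

(** The two hypotheses bound the ends of the sequence whose middle term is
R/(I_G + (S)). *)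
Lemma pdim_le_branch d v S : v \notin S ->
    pdim_le d (quot (S :|: [set y | adj v y]) (@adj G)) ->
    pdim_le d (quot (v |: S) (@adj G)) ->
  pdim_le d (quot S (@adj G)).
Proof.
move=> vS p1 p2.
have [m|m|f [g ex]] := @mono_quot_exact k _
    (graph_mono (S :|: [set y | adj v y]) (@adj G))
    (graph_mono S (@adj G)) (graph_mono (v |: S) (@adj G)) (enum_rank v).
- exact/esym/touches_colon.
- exact: touchesU1.
- exact: pdim_le_extension ex p1 p2.
Qed.

Lemma edge_ideal_mono (p : vpoly k G) :
  (p \in @edge_ideal k G) = (p \in mono_ideal (graph_mono set0 (@adj G))).
Proof.
apply/edge_idealP/idP => [[c ->]|/mono_idealP pB].
  apply: rpred_sum => x _; apply: rpred_sum => y axy.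
  apply: (@rpredZ _ _ (mono_ideal _) (c x y) (vvar k x * vvar k y)).
  apply/mono_idealP => m; rewrite -mpolyXD mcoeffX.
  case: (_ =P m) => [<- _|_]; last by rewrite eqxx.
  apply/touchesP; right; exists x, y; split=> //.
    by rewrite mulU_gt0 mnm1E eqxx.
  by rewrite mulU_gt0 eqxx orbT.
apply/edge_idealP; rewrite [p]mpolyE big_seq; apply: rpred_sum => m.
rewrite mcoeff_msupp => /pB /touchesP[[x]|[x [y [axy mx my]]]].
  by rewrite inE.
rewrite -(subm1K (i := enum_rank x) mx).
rewrite -(@subm1K _ (enum_rank y) (m - _)%MM); last first.
  rewrite mnmBE mnm1E; case: eqP => [/enum_rank_inj e|]; last by rewrite subn0.
  by rewrite e adj_irr in axy.
rewrite -addmA !mpolyXD scalerAl; apply: edge_idealMl; rewrite mulrC.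
apply/edge_idealP; exists (fun x' y' => ((x' == x) && (y' == y))%:R).
rewrite (bigD1 x) //= (bigD1 y) //= !eqxx mul1r big1 ?big1 ?addr0 // => x'.
  by move=> nx; rewrite big1 // => y' _; rewrite (negPf nx) mul0r.
by case/andP => _ /negPf->; rewrite andbF mul0r.
Qed.

Lemma edge_pi_linear :
  linear (edge_pi (k:=k) (G:=G) : (vpoly k G)^o -> edge_module k G).
Proof. by move=> a p q; rewrite edge_piD -edge_scaleE. Qed.

Lemma edge_pi_eq0 (p : vpoly k G) :
  edge_pi p = 0 <-> p \in mono_ideal (graph_mono set0 (@adj G)).
Proof.
rewrite -[0](linear0 (linear_of edge_pi_linear)) /= -edge_ideal_mono.
by rewrite edge_piP subr0.
Qed.

Lemma edge_module_iso :
  exists f : {linear quot set0 (@adj G) -> edge_module k G}, bijective f.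
Proof.
have [p pB|f fE] := mquot_lift (f := linear_of edge_pi_linear)
    (S := mono_ideal (graph_mono set0 (@adj G))).
  exact/edge_pi_eq0.
have f_inj : injective f.
  move=> u v; have [p <-] := mquot_pi_surj u; have [q <-] := mquot_pi_surj v.
  rewrite !fE /= => /edge_piP; rewrite edge_ideal_mono => pq; exact/mquot_piP.
have /choice[h hK] u : exists t, f t = u.
  have [p <-] := edge_pi_surj u.
  by exists (mquot_pi (mono_ideal (graph_mono set0 (@adj G))) p); rewrite fE.
by exists f, h => // u; apply: f_inj; rewrite hK.
Qed.

(** Suppose that [Y] is completely joined to the rest of [W], and that both [Y]
and the rest of [W] contain a vertex that is not adjacent to [l]. The family
c_x = x l for x in [Y] and c_x = 0 for the other x in [W] is compatible, but no
element [t] satisfies c_x = x t for all x: looking at the monomials l x, which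
are nonzero modulo the edge ideal when x is not adjacent to [l], the
coefficient of l in [t] would be both 1 and 0. *)
Lemma resolution_length_ge W Y l s :
    has_resolution_le (edge_module k G) s ->
    (forall x y, x \in W :\: Y -> y \in Y -> adj x y) ->
    [exists y in W :&: Y, ~~ adj l y] -> [exists z in W :\: Y, ~~ adj l z] ->
  (#|W| <= s.+1)%N.
Proof.
move=> resM adjW /exists_inP[y /setIP[yW yY] nly].
move=> /exists_inP[z /setDP[zW zY] nlz]; rewrite leqNgt; apply/negP => lt_s.
pose X : G -> vpoly k G := @vvar k G.
have X_inj : injective X.
  move=> u v /(congr1 (mcoeff U_(enum_rank v))); rewrite !mcoeffXU eqxx.
  by case: (_ =P _) => [/enum_rank_inj //|_ /eqP]; rewrite eq_sym oner_eq0.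
pose xs := [seq X x | x <- enum W].
pose c (f : vpoly k G) : edge_module k G :=
  if f \in [seq X x | x <- enum Y] then edge_pi (f * X l) else 0.
have cE x : c (X x) = if x \in Y then edge_pi (X x * X l) else 0.
  by rewrite /c mem_map // mem_enum.
have peel : peelable (vpoly k G)^o xs.
  rewrite /xs (map_comp (fun i => 'X_i) enum_rank); apply: variables_peelable.
  by rewrite map_inj_uniq ?enum_uniq //; exact: enum_rank_inj.
have size_xs : (s.+1 < size xs)%N by rewrite size_map -cardE.
have pi_scale (f g : vpoly k G) :
    f *: (edge_pi g : edge_module k G) = edge_pi (f * g).
  exact: edge_scaleE.
have compat0 u v : u \in W -> v \in W -> u \notin Y -> v \in Y ->
    X u *: c (X v) = 0.
  move=> uW vW uY vY; rewrite cE vY pi_scale; apply/edge_pi_eq0/mono_idealP => m.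
  rewrite mulrA -!mpolyXD mcoeffX.
  case: (_ =P m) => [<- _|_]; last by rewrite eqxx.
  apply: touchesD; apply/touchesP; right; exists u, v; split.
  - by apply: adjW => //; rewrite inE uY.
  - by rewrite mulU_gt0 mnm1E eqxx.
  - by rewrite mulU_gt0 eqxx orbT.
have compat : {in xs &, forall f g, f *: c g = g *: c f}.
  move=> _ _ /mapP[u + ->] /mapP[v + ->]; rewrite !mem_enum => uW vW.
  have [uY|uY] := boolP (u \in Y); have [vY|vY] := boolP (v \in Y).
  - by rewrite !cE uY vY !pi_scale; congr edge_pi; rewrite mulrCA.
  - by rewrite [c (X v)]cE (negPf vY) scaler0 compat0.
  - by rewrite [c (X u)]cE (negPf uY) scaler0 compat0.
  - by rewrite !cE (negPf uY) (negPf vY) !scaler0.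
have [t tE] := resolution_compatible peel resM size_xs compat.
have [p pE] := edge_pi_surj t.
have coefE x : x \in W -> ~~ adj l x -> p@_U_(enum_rank l) = (x \in Y)%:R.
  move=> xW nlx; have := tE (X x); rewrite map_f ?mem_enum // => /(_ isT).
  have -> : c (X x) = edge_pi ((x \in Y)%:R * (X x * X l)).
    rewrite cE; case: (x \in Y); rewrite ?mul1r // mul0r.
    apply/esym/edge_pi_eq0/rpred0.
  rewrite -pE pi_scale => /edge_piP; rewrite edge_ideal_mono => /mono_idealP.
  move=> /(_ (U_(enum_rank l) + U_(enum_rank x))%MM).
  rewrite mulrCA -mulrBr mcoeffMXU mcoeffB.
  have -> : ((x \in Y)%:R * X l)@_U_(enum_rank l) = (x \in Y)%:R.
    by case: (x \in Y); rewrite ?mul1r ?mul0r ?mcoeff0 // mcoeffXU eqxx.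
  move=> bad; apply/eqP; rewrite eq_sym -subr_eq0; apply/negPn/negP => /bad.
  have only u : (0 < (U_(enum_rank l) + U_(enum_rank x))%MM (enum_rank u))%N ->
      u = l \/ u = x.
    rewrite mulU_gt0 mnm1E (inj_eq enum_rank_inj) eq_sym.
    by case: eqP => [->|_]; [left | move=> /eqP; right].
  case/touchesP => [[u]|[u [v [auv /only + /only]]]]; first by rewrite inE.
  case=> eu [] ev; rewrite eu ev ?adj_irr ?(negPf nlx) // in auv.
  by rewrite adj_sym (negPf nlx) in auv.
have := coefE y yW nly; rewrite (coefE z zW nlz) yY (negPf zY) => /eqP.
by rewrite eq_sym oner_eq0.
Qed.

End Graph.

(** Branch on the vertices of [C] in any order. Each branching either adds the
neighbourhood of a vertex of [C], where the second hypothesis takes over, or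
moves on to a larger part of [C]. *)
Lemma pdim_le_sweep (k : fieldType) (G : sgraph) d (C S0 : {set G}) :
    pdim_le d (mono_quot k (graph_mono (S0 :|: C) (@adj G))) ->
    (forall (S : {set G}) v, S0 \subset S -> S \proper S0 :|: C -> v \in C ->
       pdim_le d (mono_quot k (graph_mono (S :|: [set y | adj v y]) (@adj G)))) ->
  pdim_le d (mono_quot k (graph_mono S0 (@adj G))).
Proof.
move=> pSC step.
suff: forall S : {set G}, S0 \subset S -> S \subset S0 :|: C ->
    pdim_le d (mono_quot k (graph_mono S (@adj G))).
  by apply=> //; exact: subsetUl.
move=> S; move cS: #|C :\: S| => c; elim: c S cS => [|c IHc] S cS S0S SC.
  have -> : S = S0 :|: C; last by [].
  apply/eqP; rewrite eqEsubset SC subUset S0S -setD_eq0.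
  by rewrite (cards0_eq cS) eqxx.
have /card_gt0P[v /setDP[vC vS]] : (0 < #|C :\: S|)%N by rewrite cS.
apply: (pdim_le_branch vS).
  apply: step => //; rewrite properE SC; apply/subsetPn; exists v => //.
  by rewrite inE vC orbT.
apply: IHc.
- have -> : C :\: (v |: S) = (C :\: S) :\ v.
    by apply/setP => x; rewrite !inE negb_or andbA.
  by move: cS; rewrite (cardsD1 v) inE vS vC => -[].
- by rewrite subsetU // S0S orbT.
- by rewrite subUset sub1set inE vC orbT.
Qed.

(** * The blow-up of a path on four vertices *)

Lemma bigmin_card_le (T : finType) (P : pred {set T}) A :
  P A -> (\big[minn/#|T|]_(B : {set T} | P B) #|B| <= #|A|)%N.
Proof.
move=> PA; rewrite -big_filter.
have : A \in [seq B <- index_enum {set T} | P B].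
  by rewrite mem_filter PA mem_index_enum.
elim: [seq _ <- _ | _] => //= B s IHs; rewrite in_cons big_cons geq_min.
by case/predU1P => [->|/IHs ->]; rewrite ?leqnn ?orbT.
Qed.

Section PathBlowup.
Variable m : nat.

Definition path_vertex : finType := ('I_4 * 'I_m)%type.

Definition path_adj : rel path_vertex := fun x y =>
  (x.1.+1 == y.1 :> nat) || (y.1.+1 == x.1 :> nat).

Lemma path_adj_sym : ssrbool.symmetric path_adj.
Proof. by move=> x y; rewrite /path_adj orbC. Qed.

Lemma path_adj_irr : irreflexive path_adj.
Proof. by move=> x; rewrite /path_adj !(gtn_eqF (ltnSn _)). Qed.

Definition path_blowup := SGraph path_adj_sym path_adj_irr.

Local Notation G := path_blowup.

Definition layer (t : nat) : {set G} := [set x : path_vertex | x.1 == t :> nat].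

Lemma card_path_blowup : #|G| = (4 * m)%N.
Proof. by rewrite card_prod !card_ord. Qed.

Lemma card_layer t : (t < 4)%N -> #|layer t| = m.
Proof.
move=> t4; have -> : layer t = setX [set Ordinal t4] [set: 'I_m].
  by apply/setP => -[i j]; rewrite !inE andbT -val_eqE.
by rewrite cardsX cards1 cardsT card_ord mul1n.
Qed.

Lemma disjoint_layers t u : t != u -> [disjoint layer t & layer u].
Proof.
move=> tu; rewrite disjoints_subset; apply/subsetP => x.
by rewrite !inE => /eqP->.
Qed.

Lemma domination_path_blowup : (0 < m)%N -> (domination_number G <= 2)%N.
Proof.
move=> m0; pose j : 'I_m := Ordinal m0.
pose A : {set G} := [set ((inord 1, j) : path_vertex); (inord 2, j)].
apply: (@leq_trans #|A|); last by rewrite cards2; case: (_ != _).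
apply: bigmin_card_le; apply/eqP/setP => x; rewrite !inE; apply/orP; right.
apply/exists_inP.
case: x => -[[|[|[|[|//]]]] i4] i /=.
- by exists (inord 1, j); rewrite ?inE ?eqxx //= /path_adj /= inordK.
- by exists (inord 2, j); rewrite ?inE ?eqxx ?orbT //= /path_adj /= inordK.
- by exists (inord 1, j); rewrite ?inE ?eqxx //= /path_adj /= inordK.
- by exists (inord 2, j); rewrite ?inE ?eqxx ?orbT //= /path_adj /= inordK.
Qed.

(** A vertex in the same layer as a member of an independent set has no
neighbour in that set, so domination forces it into the set. Dominating a
vertex of layer 0 requires a layer among 0 and 1, and a vertex of layer 3 one
among 2 and 3. *)
Lemma independent_domination_path_blowup :
  (2 * m <= independent_domination_number G)%N.
Proof.
apply: (big_ind (fun x => (2 * m <= x)%N)).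
- by rewrite card_path_blowup leq_mul2r orbT.
- by move=> x y mx my; rewrite leq_min mx.
move=> A /andP[iA /eqP dA].
have [->|m0] := posnP m; first by rewrite muln0.
have nadj x y : x \in A -> y \in A -> ~~ adj x y.
  by move=> xA yA; move/'forall_implyP: iA => /(_ x xA)/'forall_implyP/(_ y yA).
have dom y : y \in A \/ exists2 x, x \in A & adj x y.
  have : y \in closed_nbhd A by rewrite dA inE.
  by rewrite inE => /orP[|/exists_inP]; [left|right].
have layerA (x : path_vertex) : x \in A -> layer x.1 \subset A.
  move=> xA; apply/subsetP => y; rewrite inE => /eqP yx.
  have [//|[z zA zy]] := dom y.
  by case/negP: (nadj z x zA xA); move: zy; rewrite /= /path_adj yx.
pose j : 'I_m := Ordinal m0.
have [t [t2 tA]] : exists t, (t < 2)%N /\ layer t \subset A.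
  have [|[[i i'] /layerA /= liA]] := dom (inord 0, j).
    by move/layerA; rewrite /= inordK //; exists 0%N.
  by rewrite /= /path_adj /= inordK // => ij; exists i; split=> //; lia.
have [u [u2 uA]] : exists u, (2 <= u < 4)%N /\ layer u \subset A.
  have [|[[i i'] /layerA /= liA]] := dom (inord 3, j).
    by move/layerA; rewrite /= inordK //; exists 3%N.
  rewrite /= /path_adj /= inordK // => ij; exists i; split=> //.
  by have := ltn_ord i; lia.
have := subset_leq_card (_ : layer t :|: layer u \subset A).
rewrite subUset tA uA => /(_ isT); apply: leq_trans.
have -> : #|layer t :|: layer u| = (#|layer t| + #|layer u|)%N.
  apply/eqP; rewrite (leq_card_setU _ _).2; apply: disjoint_layers; lia.
by rewrite !card_layer; lia.
Qed.

Section ProjectiveDimension.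
Variable k : fieldType.

(** Branch on layer 1, then on layer 2. A vertex of layer 1 brings in layers 0
and 2, and what is left of layer 1 is then isolated; once layer 1 is gone, a
vertex of layer 2 brings in layer 3. The branching vertex is itself outside the
cover reached, which therefore has at most [3 * m - 1] vertices. If all of
layers 1 and 2 have been added, they form a cover of size [2 * m]. *)
Lemma path_blowup_pdim_le : (0 < m)%N ->
  pdim_le (3 * m).-1 (mono_quot k (graph_mono set0 (@adj G))).
Proof.
move=> m0.
have N1 v : v \in layer 1 -> [set y | adj v y] = layer 0 :|: layer 2.
  rewrite inE => /eqP v1; apply/setP => -[i j].
  by rewrite !inE /= /path_adj v1 /=; lia.
have N2 v : v \in layer 2 -> [set y | adj v y] = layer 1 :|: layer 3.
  rewrite inE => /eqP v1; apply/setP => -[i j].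
  by rewrite !inE /= /path_adj v1 /=; lia.
have cU (S T : {set G}) : (#|S :|: T| <= #|S| + #|T|)%N by exact: leq_card_setU.
apply: (@pdim_le_sweep _ _ _ (layer 1)); rewrite set0U; last first.
  move=> S v _ S1 v1; rewrite N1 //.
  have := proper_card S1; rewrite card_layer // => cS.
  apply: (@pdim_leW _ #|S :|: (layer 0 :|: layer 2)|).
    have := cU S (layer 0 :|: layer 2); have := cU (layer 0) (layer 2).
    by rewrite !card_layer //; lia.
  apply: pdim_le_cover => -[x x'] [y y']; rewrite !inE /= /path_adj /=.
  by have := ltn_ord x; have := ltn_ord y; lia.
apply: (@pdim_le_sweep _ _ _ (layer 2)).
  apply: (@pdim_leW _ #|layer 1 :|: layer 2|).
    by have := cU (layer 1) (layer 2); rewrite !card_layer //; lia.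
  apply: pdim_le_cover => -[x x'] [y y']; rewrite !inE /= /path_adj /=.
  by have := ltn_ord x; have := ltn_ord y; lia.
move=> S v S1 S2 v2; rewrite N2 // setUA (setUidPl S1).
apply: (@pdim_leW _ #|S :|: layer 3|).
  have := cU S (layer 3); have := proper_card S2; have := cU (layer 1) (layer 2).
  by rewrite !card_layer //; lia.
apply: pdim_le_cover => -[x x'] [y y'].
have := subsetP S1 (x, x'); have := subsetP S1 (y, y').
have := ltn_ord x; have := ltn_ord y; rewrite !inE /= /path_adj /=.
by case: (_ \in S); case: (_ \in S) => //=; lia.
Qed.

Lemma path_blowup_projdim : (0 < m)%N -> is_graph_projdim k G (3 * m).-1.
Proof.
move=> m0; split.
  have [f f_bij] := edge_module_iso k G.
  apply: has_resolution_le_iso f_bij _.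
  exact/pdim_le_resolution/path_blowup_pdim_le.
move=> n res_n; pose j : 'I_m := Ordinal m0.
have := @resolution_length_ge k G (~: layer 0) (layer 2) (inord 0, j) n res_n.
rewrite cardsCs setCK card_layer // card_path_blowup => H.
suff : (4 * m - m <= n.+1)%N by lia.
apply: H => [[x x'] [y y']||].
- by rewrite !inE /= /path_adj /=; have := ltn_ord x; lia.
- apply/exists_inP; exists (inord 2, j); rewrite ?inE /= /path_adj /= ?inordK //.
- apply/exists_inP; exists (inord 3, j); rewrite ?inE /= /path_adj /= ?inordK //.
Qed.

End ProjectiveDimension.
End PathBlowup.

Theorem proposition5p8 (k : fieldType) (a : nat) (ha : (1 <= a)%N) :
  exists (G : sgraph) (d : nat),
    is_graph_projdim k G d /\
    (#|G|%:Z - (independent_domination_number G)%:Z + a%:Z < d%:Z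
       < #|G|%:Z - (domination_number G)%:Z - a%:Z)%R.
Proof.
have m0 : (0 < a.+2)%N by [].
exists (path_blowup a.+2), (3 * a.+2).-1; split; first exact: path_blowup_projdim.
have := domination_path_blowup m0.
have := independent_domination_path_blowup a.+2.
rewrite card_path_blowup; lia.
Qed.
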